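(* Let $p\ge1$ and $B\ge1$ be fixed integers and $\alpha\ge0$ a fixed real number. Let $\mathbf{x}_1,\mathbf{x}_2,\dots$ be i.i.d. random vectors in $\mathbb{R}^p$ with $\mathbb{E}[\mathbf{x}_i\mathbf{x}_i^{\mathsf T}]=\Sigma$. For each $n$ divisible by $B$, let $\mathbf{X}\in\mathbb{R}^{n\times p}$ have rows $\mathbf{x}_1^{\mathsf T},\dots,\mathbf{x}_n^{\mathsf T}$, partitioned (by a nonrandom partition of the row indices) into $B$ equally-sized mini-batches $\mathbf{X}_1,\dots,\mathbf{X}_B$, and let $\mathbf{Z}(\alpha/B)$ be the associated sample cross-covariance matrix with step size $\alpha/B$. Then, as $n\to\infty$ with $p$ fixed, $\mathbf{Z}(\alpha/B)\to\Sigma(\mathbf{I}-p_{B,\alpha}(\Sigma))$ almost surely, where $$p_{B,\alpha}(\Sigma)=\sum_{i=1}^{B-1}(-1)^{i+1}\frac{(B-1)!}{(i+1)!\,(B-1-i)!}\left(\frac{\alpha}{B}\right)^i\Sigma^i.$$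
   Context: For a step size $a\in\mathbb{R}$ define $\mathbf{W}_b:=\frac{B}{n}\mathbf{X}_b^{\mathsf T}\mathbf{X}_b$ for $b=1,\dots,B$, $$\Pi_b(a):=\frac{1}{B!}\sum_{\tau\in S_B}\ \prod_{j:\,j<\tau^{-1}(b)}(\mathbf{I}-a\mathbf{W}_{\tau(j)}),$$ where $S_B$ is the set of permutations of $\{1,\dots,B\}$, the factors are multiplied from right to left in increasing order of $j$, and an empty product is $\mathbf{I}$. The sample cross-covariance matrix with step size $a$ is $$\mathbf{Z}(a):=\frac1n\sum_{b=1}^B\Pi_b(a)\mathbf{X}_b^{\mathsf T}\mathbf{X}_b\in\mathbb{R}^{p\times p}.$$ *)

(* Defs.v *)
From HB Require Import structures.
From mathcomp Require Export all_boot all_order all_algebra all_fingroup.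
From mathcomp Require Export finmap all_classical all_reals all_analysis.

Set Implicit Arguments.
Unset Strict Implicit.
Unset Printing Implicit Defensive.

Export Order.TTheory GRing.Theory Num.Theory.
Export numFieldNormedType.Exports.

#[export] Set Implicit Arguments.
#[export] Unset Strict Implicit.
#[export] Unset Printing Implicit Defensive.

Global Open Scope classical_set_scope.
Global Open Scope ring_scope.

(* R^p with its Borel sigma-algebra. The carrier is convertible to 'cV[R]_p. *)
Notation borel_cV R p := (g_sigma_algebraType (@open 'cV[R]_p)).

Definition mutually_independent d d' (T : measurableType d)
    (T' : measurableType d') (R : realType) (P : probability T R)
    (I : choiceType) (x : I -> {RV P >-> T'}) : Prop :=
  forall (J : {fset I}) (A : I -> set T'),
    (forall i, i \in J -> measurable (A i)) ->
    P (\bigcap_(i in [set` J]) (x i @^-1` A i))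
    = (\prod_(i <- J) P (x i @^-1` A i))%E.

Definition identically_distributed d d' (T : measurableType d)
    (T' : measurableType d') (R : realType) (P : probability T R)
    (I : Type) (x : I -> {RV P >-> T'}) : Prop :=
  forall (i j : I) (A : set T'),
    measurable A -> distribution P (x i) A = distribution P (x j) A.

(* The partition of the row indices is given by its labelling function
   c : 'I_n -> 'I_B, batch b being the fibre of c over b. *)
Definition batch (n B : nat) (c : 'I_n -> 'I_B) (b : 'I_B) : {set 'I_n} :=
  [set i | c i == b]%SET.

Definition equal_batches (n B : nat) (c : 'I_n -> 'I_B) : Prop :=
  forall b, #|batch c b| = (n %/ B)%N.

Definition minibatch (R : realType) (n p B : nat) (X : 'M[R]_(n, p))
    (c : 'I_n -> 'I_B) (b : 'I_B) : 'M[R]_(#|batch c b|, p) :=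
  rowsub (@enum_val _ (mem (batch c b))) X.

Definition batch_cov (R : realType) (n p B : nat) (X : 'M[R]_(n, p))
    (c : 'I_n -> 'I_B) (b : 'I_B) : 'M[R]_p :=
  (B%:R / n%:R) *: ((minibatch X c b)^T *m minibatch X c b).

(* The enumeration of 'I_B is reversed because the factors are multiplied from
   right to left in increasing order of j. *)
Definition batch_prod (R : realType) (p B : nat) (W : 'I_B -> 'M[R]_p) (a : R)
    (b : 'I_B) : 'M[R]_p :=
  (B`!%:R)^-1 *:
    \sum_(tau : 'S_B)
      \prod_(j <- rev (enum 'I_B) | (j < (tau^-1)%g b)%N)
        (1%:M - a *: W (tau j)).

Definition cross_cov (R : realType) (n p B : nat) (X : 'M[R]_(n, p))
    (c : 'I_n -> 'I_B) (a : R) : 'M[R]_p :=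
  n%:R^-1 *:
    \sum_(b < B) (batch_prod (batch_cov X c) a b
                  *m (minibatch X c b)^T *m minibatch X c b).

Definition data_matrix (R : realType) (p : nat) (u : nat -> 'cV[R]_p) (n : nat) :
    'M[R]_(n, p) :=
  \matrix_(i < n, j < p) u i j 0.

Definition shrinkage_poly (R : realType) (p B : nat) (alpha : R)
    (S : 'M[R]_p) : 'M[R]_p :=
  \sum_(1 <= i < B)
    ((-1) ^+ i.+1 * ((B.-1)`!%:R / ((i.+1)`!%:R * (B.-1 - i)`!%:R))
      * (alpha / B%:R) ^+ i) *: S ^+ i.

(* Main.v *)
(* Each W_b is an average of x_i x_i^T over an index set that may change
   completely with n, so the strong law is needed for averages
   n^-1 sum_(i in s_n) (f(x_i) - E f) over arbitrary subsets s_n of {0,..,n-1}.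
   For indicators f, Chernoff's bound is exponentially small in n and
   Borel-Cantelli applies whatever the sets s_n are; by linearity the same holds
   for simple functions. An integrable f >= 0 is a simple g <= f plus a
   remainder Z >= 0 of small mean, and the average of Z over s_n is at most
   n^-1 sum_(i < n) Z(x_i), where the subset no longer appears: truncation at 2^k and
   Chebyshev along n = 2^k bound it eventually by about twice the mean of Z.
   Hence W_b -> Sigma almost surely for every b. With every W_b equal to Sigma, the average over
   permutations makes sum_b Pi_b(a) a geometric sum, sum_(j < B) (I - a Sigma)^j,
   whose binomial expansion is B (I - p_(B,alpha)(Sigma)). *)

Require Import Defs.
From mathcomp Require Import measurable_realfun ring lra.

Import HBNNSimple.

(** * Counting indicators: exponential moments and Chernoff bounds *)

(** First Borel-Cantelli lemma: the exceptional null set is the limit superior of the events. *)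
Lemma ae_eventually_not d (T : measurableType d) (R : realType)
    (mu : {measure set T -> \bar R}) (F : (set T)^nat) :
  (forall k, measurable (F k)) -> (\sum_(n <oo) mu (F n) < +oo)%E ->
  {ae mu, forall w, \forall n \near \oo, ~ F n w}.
Proof.
move=> mF sF; exists (lim_sup_set F); split.
- apply: bigcap_measurable => // k _.
  by apply: bigcup_measurable => j _; exact: mF.
- exact: lim_sup_set_cvg0.
- move=> w /= nw N _; apply: contrapT => h; apply: nw; exists N => // n /= Nn Fn.
  by apply: h; exists n.
Qed.

Section indicators.
Context d d' (T : measurableType d) (V : measurableType d') (R : realType)
  (P : probability T R) (x : nat -> {RV P >-> V}).
Context (indep : mutually_independent x).
Context (ident : identically_distributed x).

Lemma prob_preimage_eq i (U : set V) : measurable U ->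
  P (x i @^-1` U) = (fine (distribution P (x 0) U))%:E.
Proof.
move=> mU; rewrite fineK ?fin_num_measure//.
exact: (ident i 0 mU).
Qed.

Lemma measurable_indic_rv i (U : set V) : measurable U ->
  measurable_fun setT (fun w => \1_U (x i w) : R).
Proof.
move=> mU; apply: (@measurableT_comp _ _ _ _ _ _ (\1_U : V -> R)) => //.
Qed.

(** The intersection runs over a finite set to match [mutually_independent]; repetitions in [t] are
    harmless because indicators are idempotent. *)
Lemma prod_indic (U : set V) (t : seq nat) w :
  \prod_(i <- t) (\1_U (x i w) : R) =
  \1_(\bigcap_(i in [set` [fset i in t]%fset]) (x i @^-1` U)) w.
Proof.
rewrite indicE; case: (boolP (w \in _)).
  rewrite inE => h; rewrite big_seq big1// => i it.
  by rewrite indicE mem_set//; apply: h; rewrite /= !inE.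
rewrite notin_setE => h.
move: h => /existsNP[i].
move=> /not_implyP[]; rewrite /= inE => it Ui.
by rewrite (big_rem i)//= indicE memNset ?mul0r.
Qed.

(* Expanding one factor 1 + c 1_U moves its index from s to t, which is what
   lets independence be used on events only. *)
Lemma integral_prod_indic (U : set V) (c : R) (s t : seq nat) :
  measurable U -> 0 <= c -> uniq (t ++ s) ->
  (\int[P]_w (\prod_(i <- t) \1_U (x i w) *
              \prod_(i <- s) (1 + c * \1_U (x i w)))%:E)%E =
  (let p := fine (distribution P (x 0) U) in
   p ^+ size t * (1 + c * p) ^+ size s)%:E.
Proof.
move=> mU c0; set p := fine _.
have mprod (r : seq nat) (f : nat -> T -> R) : (forall i, measurable_fun setT (f i)) ->
    measurable_fun setT (fun w => \prod_(i <- r) f i w).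
  by move=> mf; apply: measurable_prod => i _.
have mI i : measurable_fun setT (fun w => 1 + c * \1_U (x i w) : R).
  apply: measurable_funD => //; apply: measurable_funM => //.
  exact: measurable_indic_rv.
have I0 i w : 0 <= 1 + c * \1_U (x i w) :> R.
  by rewrite addr_ge0// mulr_ge0.
elim: s t => [|a s IH] t.
  rewrite cats0 => ut; under eq_integral do rewrite big_nil mulr1 prod_indic.
  rewrite integral_indic//; last first.
    apply: fin_bigcap_measurable; first exact: finite_fset.
    by move=> i _; rewrite -[_ @^-1` _]setTI; exact: measurable_funP.
  rewrite setIT [LHS](indep (A := fun=> U))//= expr0 mulr1.
  under eq_bigr do rewrite prob_preimage_eq//.
  (* Independence gives a product over the finite set of entries of [t]; as [t] has no duplicates,
     it is the product along [t]. *)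
  rewrite (perm_big t)/=; last first.
    apply: uniq_perm => //; first exact: fset_uniq.
    by move=> i; rewrite inE.
  by rewrite prodEFin big_const_seq count_predT iter_mulr_1.
move=> uts.
have ua : uniq ((a :: t) ++ s).
  by rewrite -[(a :: t) ++ s]/([:: a] ++ t ++ s) uniq_catCA.
have us : uniq (t ++ s) by move: ua => /= /andP[].
under eq_integral => w _.
  have -> : \prod_(i <- t) \1_U (x i w) *
        \prod_(i <- (a :: s)) (1 + c * \1_U (x i w)) =
    \prod_(i <- t) \1_U (x i w) * \prod_(i <- s) (1 + c * \1_U (x i w)) +
     c * (\prod_(i <- a :: t) \1_U (x i w) * \prod_(i <- s) (1 + c * \1_U (x i w))) :> R.
    by rewrite !big_cons; ring.
  rewrite EFinD (EFinM c); over.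
have P0 (r r' : seq nat) w : (0 <= (\prod_(i <- r) \1_U (x i w) *
     \prod_(i <- r') (1 + c * \1_U (x i w)))%:E :> \bar R)%E.
  by rewrite lee_fin mulr_ge0// prodr_ge0.
have mP (r r' : seq nat) : measurable_fun setT (fun w => (\prod_(i <- r) \1_U (x i w) *
     \prod_(i <- r') (1 + c * \1_U (x i w)))%:E : \bar R).
  apply/measurable_EFinP; apply: measurable_funM; apply: mprod => // i.
  exact: measurable_indic_rv.
rewrite ge0_integralD//; last 2 first.
- by move=> w _; rewrite mule_ge0 ?P0 ?lee_fin.
- by apply: emeasurable_funM => //; exact: mP.
rewrite ge0_integralZl_EFin//.
rewrite !IH//= -EFinM -EFinD; congr EFin.
by rewrite !exprS; ring.
Qed.

End indicators.

(** Inverting [1 - r <= expR (- r)] bounds [expR r] by 1/(1 - r), and (1 - r)(1 + r + 2r^2) = 1 +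
    r^2 (1 - 2r) is at least 1 for r at most 1/2. *)
Lemma expR_le_quadratic (R : realType) (r : R) : 0 <= r -> r <= 2^-1 ->
  expR r <= 1 + r + 2 * r ^+ 2.
Proof.
move=> r0 r1; have := expR_ge1Dx (- r); rewrite expRN => h.
rewrite -[expR r]invrK invf_ple ?posrE ?invr_gt0 ?expR_gt0//; last by nra.
by apply: le_trans h; rewrite -[leLHS]div1r ler_pdivrMr; nra.
Qed.

Section tails.
Context d d' (T : measurableType d) (V : measurableType d') (R : realType)
  (P : probability T R) (x : nat -> {RV P >-> V}).
Context (indep : mutually_independent x).
Context (ident : identically_distributed x).

Lemma measurable_sum_indic (U : set V) (s : seq nat) : measurable U ->
  measurable_fun setT (fun w => \sum_(i <- s) (\1_U (x i w) : R)).
Proof.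
by move=> mU; apply: measurable_sum => i; exact: measurable_indic_rv.
Qed.

(** Because the deviation is measured against [n] and not [size s], the bound is exponential in [n]
    even for small index sets; this is what makes it summable for arbitrary subsets. *)
Lemma indic_upper_tail (U : set V) (s : seq nat) n (e : R) :
  measurable U -> uniq s -> (size s <= n)%N -> 0 < e -> e <= 1 ->
  (P [set w | ((size s)%:R * fine (distribution P (x 0) U) + n%:R * e <=
    \sum_(i <- s) \1_U (x i w))%R] <= (expR (- (e ^+ 2 / 8)) ^+ n)%:E)%E.
Proof.
move=> mU us sn e0 e1; set p := fine _.
have p0 : 0 <= p by rewrite fine_ge0.
have p1 : p <= 1.
  by rewrite -lee_fin fineK ?fin_num_measure// probability_le1.
pose X : {RV P >-> R} := mfun_Sub (mem_set (measurable_sum_indic s mU)).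
(* The Chernoff parameter e/4 gains n e^2/4 in the exponent, while the quadratic error of the
   exponential costs at most n times 2 (e/4)^2 = e^2/8; the net exponent is - n e^2/8. *)
have r0 : 0 < e / 4 by lra.
have E0 : 0 <= expR (e / 4) - 1 by have := expR_ge1Dx (e / 4); lra.
have := chernoff X ((size s)%:R * p + n%:R * e) r0.
rewrite /X mfun_valP => /le_trans; apply.
rewrite /mmt_gen_fun unlock.
(* On an indicator, exp(r 1_U) = 1 + (exp(r) - 1) 1_U, so the moment generating function is an
   integral computed by [integral_prod_indic]. *)
have -> : (\int[P]_w ((expR \o (e / 4) \o* (fun w =>
     \sum_(i <- s) \1_U (x i w))) w)%:E)%E =
   ((1 + (expR (e / 4) - 1) * p) ^+ size s)%:E.
  rewrite -[_ ^+ _]mul1r -(expr0 p).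
  rewrite -(integral_prod_indic indep ident (t := [::]) mU)//.
  apply: eq_integral => w _; congr EFin; rewrite big_nil mul1r /= mulr_suml expR_sum.
  apply: eq_bigr => i _; rewrite indicE; case: (_ \in _) => /=.
    by rewrite mul1r mulr1 addrC subrK.
  by rewrite mul0r mulr0 addr0 expR0.
rewrite -EFinM lee_fin.
have E1 : expR (e / 4) - 1 - e / 4 <= e ^+ 2 / 8.
  by have := @expR_le_quadratic _ (e / 4); lra.
apply: (@le_trans _ _ (expR ((expR (e / 4) - 1) * p) ^+ size s *
   expR (- (e / 4 * ((size s)%:R * p + n%:R * e))))).
  rewrite ler_wpM2r ?expR_ge0// lerXn2r ?nnegrE ?expR_ge0//.
    by rewrite addr_ge0// mulr_ge0.
  exact: expR_ge1Dx.
rewrite -!expRM_natl -expRD ler_expR.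
have snR : (size s)%:R <= n%:R :> R by rewrite ler_nat.
have s0 : 0 <= (size s)%:R :> R by [].
have n0 : 0 <= n%:R :> R by [].
set a := expR (e / 4) in E0 E1 *; set m := (size s)%:R in snR s0 *.
have : m * p * (a - 1 - e / 4) <= n%:R * (e ^+ 2 / 8).
  apply: (@le_trans _ _ (m * p * (e ^+ 2 / 8))).
    by rewrite ler_wpM2l// mulr_ge0.
  rewrite ler_wpM2r//; first by nra.
  by rewrite (le_trans _ snR)// ler_piMr.
nra.
Qed.

End tails.

Lemma nneseries_le_bound (R : realType) (u : nat -> \bar R) (C : \bar R) :
  (forall n, 0 <= u n)%E -> (forall n, \sum_(0 <= i < n) u i <= C)%E ->
  (\sum_(i <oo) u i <= C)%E.
Proof.
move=> u0 uC; apply: lime_le; first exact: is_cvg_nneseries.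
by apply: nearW => n; exact: uC.
Qed.

(** The form of Borel-Cantelli that serves both for the geometric Chernoff tails and for the dyadic
    Chebyshev tails. *)
Lemma ae_eventually_not_le d (T : measurableType d) (R : realType)
    (mu : {measure set T -> \bar R}) (F : (set T)^nat) (a : nat -> \bar R) (C : R) :
  (forall k, measurable (F k)) -> (forall k, mu (F k) <= a k)%E ->
  (forall n, \sum_(0 <= i < n) a i <= C%:E)%E ->
  {ae mu, forall w, \forall n \near \oo, ~ F n w}.
Proof.
move=> mF Fa aC; apply: ae_eventually_not => //.
apply: (@le_lt_trans _ _ C%:E); last exact: ltry.
apply: nneseries_le_bound => // n.
exact: le_trans (lee_sum _ (fun i _ => Fa i)) (aC n).
Qed.

(* The normalisation is by n, not by the size of s n: no growth condition on
   s n is then needed. *)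
Definition centered_average_cvg0 d d' (T : measurableType d)
    (V : measurableType d') (R : realType) (P : probability T R)
    (x : nat -> {RV P >-> V}) (s : nat -> seq nat) (f : V -> R) (a : R) :=
  {ae P, forall w, n%:R^-1 * \sum_(i <- s n) (f (x i w) - a) @[n --> \oo] --> 0}.

Section indicator_average.
Context d d' (T : measurableType d) (V : measurableType d') (R : realType)
  (P : probability T R) (x : nat -> {RV P >-> V}).
Context (indep : mutually_independent x).
Context (ident : identically_distributed x).
Context (s : nat -> seq nat) (us : forall n, uniq (s n))
  (sn : forall n, (size (s n) <= n)%N).

Lemma ae_indic_sum_lt (U : set V) (e : R) : measurable U -> 0 < e -> e <= 1 ->
  {ae P, forall w, \forall n \near \oo, \sum_(i <- s n) \1_U (x i w) <
     (size (s n))%:R * fine (distribution P (x 0) U) + n%:R * e}.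
Proof.
move=> mU e0 e1; set p := fine _.
pose F n := [set w | (size (s n))%:R * p + n%:R * e <= \sum_(i <- s n) \1_U (x i w)].
set q := expR (- (e ^+ 2 / 8)).
have q0 : 0 < q by exact: expR_gt0.
have q1 : q < 1 by rewrite /q expR_lt1 oppr_lt0; nra.
have : {ae P, forall w, \forall n \near \oo, ~ F n w}.
  apply: (@ae_eventually_not_le _ _ _ _ _ (fun n => (q ^+ n)%:E) (1 * (1 - q)^-1)).
  - move=> n; rewrite -[F n]setTI; apply: measurable_fun_ler => //.
    exact: measurable_sum_indic.
  - by move=> n; exact: indic_upper_tail.
  - move=> n; have := @geometric_le_lim _ n 1 q ler01 q0.
    rewrite gtr0_norm// => /(_ q1); rewrite /series/= sumEFin lee_fin.
    by under eq_bigr do rewrite mul1r.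
apply: filterS => w; apply: filterS => n /negP.
by rewrite -ltNge.
Qed.

(** A lower deviation for [U] is an upper deviation for its complement, so the one-sided bound
    suffices. Tolerances 1/(k+1) keep the exceptional set a countable union of null sets. *)
Lemma indic_average_cvg0 (U : set V) : measurable U ->
  centered_average_cvg0 x s \1_U (fine (distribution P (x 0) U)).
Proof.
move=> mU; rewrite /centered_average_cvg0; set p := fine _.
have pC : fine (distribution P (x 0) (~` U)) = 1 - p.
  rewrite probability_setC// fineB ?fin_num_measure//.
have e1 k : (k.+1%:R^-1 : R) <= 1 by rewrite invf_le1// ler1n.
have H1 : {ae P, forall w, forall k, \forall n \near \oo, \sum_(i <- s n) \1_U (x i w) <
     (size (s n))%:R * p + n%:R * k.+1%:R^-1}.
  by apply/ae_foralln => k; apply: ae_indic_sum_lt.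
have H2 : {ae P, forall w, forall k, \forall n \near \oo, \sum_(i <- s n) \1_(~` U) (x i w) <
     (size (s n))%:R * (1 - p) + n%:R * k.+1%:R^-1}.
  apply/ae_foralln => k; rewrite -pC.
  by apply: ae_indic_sum_lt => //; exact: measurableC.
apply: filterS2 H1 H2 => w H1 H2.
apply/cvgr0Pnorm_le => e e0.
have [k ke] : exists k : nat, (k.+1%:R^-1 : R) < e.
  by have [k] := ltr_add_invr e0; rewrite add0r; exists k.
near=> n.
have n0 : 0 < n%:R :> R by rewrite ltr0n; near: n; exact: nbhs_infty_gt.
rewrite normrM gtr0_norm ?invr_gt0// ler_pdivrMl//.
rewrite sumrB big_const_seq count_predT iter_addr_0 -[p *+ _]mulr_natl.
have h1 : \sum_(i <- s n) \1_U (x i w) < (size (s n))%:R * p + n%:R * k.+1%:R^-1.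
  by near: n; exact: H1.
have h2 : \sum_(i <- s n) \1_(~` U) (x i w) < (size (s n))%:R * (1 - p) + n%:R * k.+1%:R^-1.
  by near: n; exact: H2.
have h3 : \sum_(i <- s n) \1_(~` U) (x i w) = (size (s n))%:R - \sum_(i <- s n) (\1_U (x i w) : R).
  rewrite -(count_predT (s n)) -sum1_count natr_sum -sumrB.
  apply: eq_bigr => i _; rewrite !indicE in_setC.
  by case: (_ \in _); rewrite /= ?subrr ?subr0.
have h4 : n%:R * k.+1%:R^-1 <= n%:R * e by rewrite ler_pM2l// ltW.
move: h1 h2 h4; rewrite h3.
move: (\sum_(i <- s n) _) (n%:R / _) (n%:R * e) (_%:R) => S q b m h1 h2 h4.
by rewrite ler_norml; apply/andP; split; lra.
Unshelve. all: by end_near. Qed.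

End indicator_average.

Section linearity.
Context d d' (T : measurableType d) (V : measurableType d') (R : realType)
  (P : probability T R) (x : nat -> {RV P >-> V}) (s : nat -> seq nat).

Lemma centered_average_cvg0_sum (I : eqType) (r : seq I) (k : I -> R)
    (f : I -> V -> R) (a : I -> R) :
  (forall i, i \in r -> centered_average_cvg0 x s (f i) (a i)) ->
  centered_average_cvg0 x s (fun v => \sum_(i <- r) k i * f i v)
    (\sum_(i <- r) k i * a i).
Proof.
move=> fa; pose S i w n := n%:R^-1 * \sum_(j <- s n) (f i (x j w) - a i) : R.
have : {ae P, forall w, forall i, i \in r -> S i w n @[n --> \oo] --> 0}.
  elim: r fa => [|i r IH] fa; first by apply: aeW.
  have fai := fa i (mem_head _ _).
  have IH' := IH (fun j jr => fa j (mem_behead (s := i :: r) jr)).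
  apply: filterS2 fai IH' => w h1 h2 j.
  by rewrite inE => /predU1P[->//|]; exact: h2.
apply: filterS => w h.
rewrite (_ : (fun n => _) = (fun n => \sum_(i <- r) k i * S i w n)); last first.
  apply/funext => n; rewrite /S.
  under eq_bigr do rewrite -sumrB.
  rewrite exchange_big/= mulr_sumr; apply: eq_bigr => i _.
  rewrite mulrCA; congr (_ * _); rewrite mulr_sumr.
  by apply: eq_bigr => j _; rewrite mulrBr.
(* The limit 0 is written as a combination of zeros so that the sum converges term by term. *)
have -> : nbhs (0 : R) = nbhs (\sum_(i <- r) k i * 0 : R).
  by rewrite big1// => i _; rewrite mulr0.
rewrite big_seq; under eq_fun do rewrite big_seq.
apply: cvg_big => [|i ir]; first exact: add_continuous.
by apply: cvgMr; exact: h.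
Qed.

End linearity.


Section simple.
Context d d' (T : measurableType d) (V : measurableType d') (R : realType)
  (P : probability T R) (x : nat -> {RV P >-> V}).
Context (indep : mutually_independent x).
Context (ident : identically_distributed x).
Context (s : nat -> seq nat) (us : forall n, uniq (s n))
  (sn : forall n, (size (s n) <= n)%N).

Lemma nnsfun_average_cvg0 (g : {nnsfun V >-> R}) :
  centered_average_cvg0 x s g (fine (\int[distribution P (x 0)]_v (g v)%:E)).
Proof.
pose r := fset_set (range g).
have gE : (g : V -> R) = fun v => \sum_(y <- r) y * \1_(g @^-1` [set y]) v.
  by apply/funext => v; rewrite fimfunE fsbig_finite.
have -> : (\int[distribution P (x 0)]_v (g v)%:E)%E =
    (\sum_(y <- r) y * fine (distribution P (x 0) (g @^-1` [set y])))%:E.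
  rewrite integralT_nnsfun sintegralE fsbig_finite//= -/r -sumEFin.
  by apply: eq_bigr => y _; rewrite EFinM fineK// fin_num_measure.
rewrite /= [X in centered_average_cvg0 _ _ X]gE.
apply: centered_average_cvg0_sum => y _.
by apply: indic_average_cvg0.
Qed.

End simple.

(** * Pairwise independence and the tail of a nonnegative function *)

Section pairs.
Context d d' (T : measurableType d) (V : measurableType d') (R : realType)
  (P : probability T R) (x : nat -> {RV P >-> V}).
Context (indep : mutually_independent x).
Context (ident : identically_distributed x).

Lemma integral_rv_law i (f : V -> R) : measurable_fun setT f ->
  (forall v, 0 <= f v) ->
  (\int[P]_w (f (x i w))%:E = \int[distribution P (x 0)]_v (f v)%:E)%E.
Proof.
move=> mf f0.
rewrite -(ge0_integral_distribution (x i) (f := EFin \o f)); last 2 first.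
- exact/measurable_EFinP.
- by move=> v; rewrite lee_fin.
by apply: eq_measure_integral => A mA _; exact: ident.
Qed.

Lemma prob_pair i j (A B : set V) : i != j -> measurable A -> measurable B ->
  P (x i @^-1` A `&` x j @^-1` B) = (P (x i @^-1` A) * P (x j @^-1` B))%E.
Proof.
move=> ij mA mB.
have := @indep [fset i; j]%fset (fun k => if k == i then A else B).
rewrite big_fsetU1/= ?inE// big_seq_fset1/= eqxx eq_sym (negbTE ij) => <-.
  congr (P _); apply/seteqP; split=> [w [wi wj] k /=|w h].
    by rewrite !inE => /orP[] /eqP ->; rewrite ?eqxx// eq_sym (negbTE ij).
  have hi : i \in [fset i; j]%fset by rewrite !inE eqxx.
  have hj : j \in [fset i; j]%fset by rewrite !inE eqxx orbT.
  split; first by have := h i hi; rewrite /= eqxx.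
  by have := h j hj; rewrite /= eq_sym (negbTE ij).
by move=> k _; case: ifP.
Qed.

(** The joint law of [x i] and [x j] agrees with the product of their laws on rectangles, hence
    everywhere; Tonelli then factors the integral, and finiteness lets the inner integral be pulled
    out as a real constant. *)
Lemma expectation_pair i j (f : V -> R) : i != j -> measurable_fun setT f ->
  (forall v, 0 <= f v) -> (\int[distribution P (x 0)]_v (f v)%:E < +oo)%E ->
  (\int[P]_w (f (x i w) * f (x j w))%:E =
   (\int[distribution P (x 0)]_v (f v)%:E) * (\int[distribution P (x 0)]_v (f v)%:E))%E.
Proof.
move=> ij mf f0 foo.
have mh : measurable_fun setT (fun w => (x i w, x j w)).
  by apply: measurable_fun_pair.
pose h : {RV P >-> (V * V)%type} := mfun_Sub (mem_set mh).
pose g (z : V * V) := (f z.1 * f z.2)%:E.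
have mg : measurable_fun setT g.
  apply/measurable_EFinP; apply: measurable_funM; apply: measurableT_comp => //.
have g0 z : (0 <= g z)%E by rewrite lee_fin mulr_ge0.
have -> : (\int[P]_w (f (x i w) * f (x j w))%:E = \int[distribution P h]_z g z)%E.
  by rewrite ge0_integral_distribution.
pose m1 := distribution P (x i); pose m2 := distribution P (x j).
rewrite (@eq_measure_integral _ _ _ _ (m1 \x m2)%E); last first.
  move=> A mA _; symmetry; apply: product_measure_unique => // A1 A2 mA1 mA2.
  exact: prob_pair.
rewrite fubini_tonelli1//.
rewrite /fubini_F /g; set c := (\int[distribution P (x 0)]_v (f v)%:E)%E.
have law k : (\int[distribution P (x k)]_v (f v)%:E = c)%E.
  by apply: eq_measure_integral => A mA _; exact: ident.
have cfin : c \is a fin_num by rewrite ge0_fin_numE// integral_ge0// => v _; rewrite lee_fin.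
have mfE : measurable_fun setT (EFin \o f) by exact/measurable_EFinP.
under eq_integral => u _.
  under eq_integral => v _ do rewrite /= EFinM.
  rewrite ge0_integralZl_EFin//; last by move=> v _; rewrite lee_fin.
  rewrite law -(fineK cfin).
  over.
have c0 : (0 <= c)%E by apply: integral_ge0 => v _; rewrite lee_fin.
rewrite ge0_integralZr//; first by rewrite -/c fineK// law.
- by move=> v _; rewrite lee_fin.
- by rewrite -/c lee_fin fine_ge0.
Qed.

Lemma bounded_Lfun2 (X : T -> R) (M : R) : measurable_fun setT X ->
  (forall w, 0 <= X w <= M) -> X \in Lfun P 2%:E.
Proof.
move=> mX XM; rewrite inE/=; apply/andP; split; rewrite inE//=.
rewrite /finite_norm unlock poweR_lty//.
apply: (@le_lt_trans _ _ (\int[P]_w (cst (M ^+ 2)%:E w))%E); last first.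
  rewrite integral_cst// -ge0_fin_numE ?mule_ge0 ?lee_fin ?sqr_ge0//.
  by rewrite fin_numM// fin_num_measure.
have mX2 : measurable_fun setT (fun w => (X w ^+ 2)%:E).
  by apply/measurable_EFinP; exact: measurable_funX.
under eq_integral => w _.
  rewrite /= (_ : (`|X w| `^ 2)%R = X w ^+ 2); last first.
    by rewrite powR_mulrn// real_normK// num_real.
  over.
apply: ge0_le_integral => //.
- by move=> w _; rewrite lee_fin sqr_ge0.
- move=> w _; rewrite lee_fin; have /andP[X0 X1] := XM w.
  by rewrite lerXn2r// nnegrE (le_trans X0).
Qed.

End pairs.

Section variance_of_sums.
Context d d' (T : measurableType d) (V : measurableType d') (R : realType)
  (P : probability T R) (x : nat -> {RV P >-> V}).
Context (indep : mutually_independent x).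
Context (ident : identically_distributed x).
Context (f : V -> R) (M : R) (mf : measurable_fun setT f)
  (f0 : forall v, 0 <= f v) (fM : forall v, f v <= M).

Let mfx i : measurable_fun setT (f \o x i).
Proof. exact: measurableT_comp. Qed.

Let law := distribution P (x 0).

Lemma integral_law_bounded : (\int[law]_v (f v)%:E < +oo)%E.
Proof.
rewrite /law -(integral_rv_law ident 0 mf f0).
apply: (@le_lt_trans _ _ (\int[P]_w (cst M%:E w))%E).
  apply: ge0_le_integral => //.
  - by move=> w _; rewrite lee_fin.
  - exact/measurable_EFinP/mfx.
  - by move=> w _; rewrite lee_fin.
rewrite integral_cst//.
by rewrite ltey_eq fin_numM// fin_num_measure.
Qed.

Lemma Lfun2_rv i : f \o x i \in Lfun P 2%:E.
Proof.
by apply: (@bounded_Lfun2 _ _ _ _ _ M) => // w; rewrite f0 fM.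
Qed.

Lemma expectation_rv i : 'E_P[f \o x i]%E = (\int[law]_v (f v)%:E)%E.
Proof. by rewrite unlock -(integral_rv_law ident i mf f0). Qed.

Lemma covariance_rv_eq0 i j : i != j ->
  (covariance P (f \o x i) (f \o x j) = 0)%E.
Proof.
move=> ij.
have Pfin : P setT \is a fin_num := fin_num_measure P _ measurableT.
have X1 k := Lfun_subset12 Pfin (Lfun2_rv k).
rewrite covarianceE//; last exact: Lfun2_mul_Lfun1 (Lfun2_rv i) (Lfun2_rv j).
rewrite !expectation_rv unlock.
rewrite (_ : (\int[P]_w _)%E = ((\int[law]_v (f v)%:E) * (\int[law]_v (f v)%:E))%E).
  rewrite subee// fin_numM// -(expectation_rv 0); exact: expectation_fin_num.
by apply: expectation_pair => //; exact: integral_law_bounded.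
Qed.

Lemma Lfun2_sum (s : seq nat) : (fun w => \sum_(i <- s) f (x i w)) \in Lfun P 2%:E.
Proof.
rewrite (_ : (fun w => _) = \sum_(i <- s) (f \o x i)); last first.
  by apply/funext => w; rewrite fct_sumE.
by apply: rpred_sum => *; rewrite ?lee1n ?Lfun2_rv.
Qed.

Lemma covariance_sum_eq0 i (s : seq nat) : i \notin s ->
  (covariance P (f \o x i) (fun w => (\sum_(j <- s) f (x j w))%R) = 0)%E.
Proof.
elim: s => [_|j s IH].
  under [X in covariance _ _ X]eq_fun do rewrite big_nil.
  exact: covariance_cst_r.
rewrite inE negb_or => /andP[ij jis].
rewrite (_ : (fun w => _) = (f \o x j) \+ (fun w => \sum_(j <- s) f (x j w))); last first.
  by apply/funext => w; rewrite /= big_cons.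
rewrite covarianceDr ?Lfun2_rv ?Lfun2_sum//.
by rewrite covariance_rv_eq0// IH// add0e.
Qed.

(** Distinct indices are uncorrelated, so variances add up, and each variance is at most the second
    moment. *)
Lemma variance_sum_le (s : seq nat) : uniq s ->
  ('V_P[fun w => (\sum_(i <- s) f (x i w))%R] <=
   (size s)%:R%:E * \int[law]_v (f v ^+ 2)%:E)%E.
Proof.
elim: s => [_|i s IH /= /andP[ins us]].
  under [X in variance _ X]eq_fun do rewrite big_nil.
  by rewrite variance_cst mul0e.
rewrite (_ : (fun w => _) = (f \o x i) \+ (fun w => \sum_(j <- s) f (x j w))); last first.
  by apply/funext => w; rewrite /= big_cons.
rewrite varianceD ?Lfun2_rv ?Lfun2_sum// covariance_sum_eq0// mule0 adde0.
rewrite -natr1 addrC EFinD ge0_muleDl ?lee_fin// mul1e leeD ?IH//.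
rewrite varianceE ?Lfun2_rv//.
rewrite (@le_trans _ _ ('E_P[(f \o x i) ^+ 2])%E)//.
  by rewrite geeDl// oppe_le0 expectation_rv sqre_ge0.
rewrite unlock -(integral_rv_law ident i (f := fun v => f v ^+ 2))//.
- exact: measurable_funX.
- by move=> v; rewrite sqr_ge0.
Qed.

Lemma expectation_sum_rv (s : seq nat) :
  ('E_P[fun w => (\sum_(i <- s) f (x i w))%R] =
   (size s)%:R%:E * \int[law]_v (f v)%:E)%E.
Proof.
rewrite unlock.
under eq_integral do rewrite -sumEFin.
rewrite ge0_integral_sum//.
- under eq_bigr do rewrite (integral_rv_law ident)//.
  have cfin : (\int[law]_v (f v)%:E)%E \is a fin_num.
    by rewrite -(expectation_rv 0) expectation_fin_num// Lfun_subset12 ?Lfun2_rv ?fin_num_measure.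
  rewrite -/law -(fineK cfin) sumEFin big_const_seq count_predT iter_addr_0.
  by rewrite -EFinM mulr_natl.
- by move=> i; exact/measurable_EFinP/mfx.
- by move=> i w _; rewrite lee_fin.
Qed.

End variance_of_sums.

(* 2^k min(1, (z / 2^k)^2): the first regime pays for the variance after
   truncation at 2^k, the second for the probability of exceeding 2^k. *)
Definition dyadic_profile (R : realType) (k : nat) (z : R) : R :=
  if z <= 2 ^+ k then z ^+ 2 / 2 ^+ k else 2 ^+ k.

Lemma dyadic_profile_ge0 (R : realType) k (z : R) : 0 <= dyadic_profile k z.
Proof.
by rewrite /dyadic_profile; case: ifP => _; [rewrite divr_ge0 ?sqr_ge0 ?exprn_ge0|rewrite exprn_ge0].
Qed.

Lemma measurable_dyadic_profile (R : realType) k :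
  measurable_fun setT (@dyadic_profile R k).
Proof.
apply: measurable_fun_ifT => //.
  exact: measurable_fun_ler.
by apply: measurable_funM => //; exact: measurable_funX.
Qed.

Lemma sum_dyadic_profile_le (R : realType) n (z : R) : 0 <= z ->
  \sum_(0 <= k < n) dyadic_profile k z <= 4 * z.
Proof.
(* min(1, z^2) + 2 b (z / 2) <= b z <= 4 z; the bound 4 z itself does not
   survive the induction on n, which peels off k = 0 and rescales z. *)
pose b (z : R) := if z <= 1 then 2 * z ^+ 2 else 4 * z - 1.
move=> z0; apply: (@le_trans _ _ (b z)); last first.
  rewrite /b; case: (leP z 1) => h; last by lra.
  by have : 0 <= z * (1 - z) by [rewrite mulr_ge0// subr_ge0]; rewrite expr2; lra.
elim: n z z0 => [|n IH] z z0.
  by rewrite big_geq// /b; case: (leP z 1) => h; [rewrite mulr_ge0 ?sqr_ge0|lra].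
(* Halving [z] shifts the dyadic index by one, which turns the sum without its first term into the
   induction hypothesis at [z / 2]. *)
have scale k : dyadic_profile k.+1 z = 2 * dyadic_profile k (z / 2).
  rewrite /dyadic_profile ler_pdivrMr// -exprSr exprS.
  case: ifP => _ //.
  have : 2 ^+ k != 0 :> R by rewrite expf_neq0.
  move: (2 ^+ k) => u u0.
  by field; rewrite u0.
rewrite big_nat_recl//.
under eq_bigr do rewrite scale.
rewrite -mulr_sumr.
have z20 : 0 <= z / 2 by lra.
have := IH (z / 2) z20.
move: (\sum_(0 <= i < n) _) => S.
rewrite /dyadic_profile /b expr0 divr1.
case: (leP (z / 2) 1); case: (leP z 1); nra.
Qed.

Section tail.
Context d d' (T : measurableType d) (V : measurableType d') (R : realType)
  (P : probability T R) (x : nat -> {RV P >-> V}).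
Context (indep : mutually_independent x).
Context (ident : identically_distributed x).
Context (Z : V -> R) (m : R) (mZ : measurable_fun setT Z)
  (Z0 : forall v, 0 <= Z v)
  (intZ : (\int[distribution P (x 0)]_v (Z v)%:E = m%:E)%E).

Let law := distribution P (x 0).

Lemma measurable_sum_rv (f : V -> R) (s : seq nat) : measurable_fun setT f ->
  measurable_fun setT (fun w => \sum_(i <- s) f (x i w)).
Proof. by move=> mf; apply: measurable_sum => i; exact: measurableT_comp. Qed.

(** With N = 2^k, let [f] be [Z] set to 0 above N. If the sum is too large, then either some Z(x_i)
    exceeds N ([Big]), or the sum [S] of the f(x_i) is at least N e away from its mean ([Dev]), that
    mean being at most N m. *)
Lemma dyadic_tail (e : R) k : 0 < e ->
  (P [set w | ((2 ^ k)%N%:R * (m + e) < \sum_(i <- iota 0 (2 ^ k)) Z (x i w))%R] <=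
   (1 + e ^- 2)%:E * \int[law]_v (dyadic_profile k (Z v))%:E)%E.
Proof.
move=> e0; set N := (2 ^ k)%N; set I := (\int[_]_v _)%E.
have N0 : 0 < N%:R :> R by rewrite ltr0n expn_gt0.
have NE : N%:R = 2 ^+ k :> R by rewrite natrX.
pose f v := if Z v <= N%:R then Z v else 0.
have mf : measurable_fun setT f.
  by apply: measurable_fun_ifT => //; exact: measurable_fun_ler.
have f0 v : 0 <= f v by rewrite /f; case: ifP.
have fN v : f v <= N%:R by rewrite /f; case: ifP => // _; exact: ltW.
have mdy : measurable_fun setT (fun v => (dyadic_profile k (Z v))%:E : \bar R).
  by apply/measurable_EFinP; apply: measurableT_comp => //; exact: measurable_dyadic_profile.
pose S w := \sum_(i <- iota 0 N) f (x i w).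
have mS : measurable_fun setT S by exact: measurable_sum_rv.
pose a := fine (\int[law]_v (f v)%:E)%E.
have fint : (\int[law]_v (f v)%:E = a%:E)%E.
  rewrite fineK// ge0_fin_numE; first exact: (integral_law_bounded ident mf f0 fN).
  by apply: integral_ge0 => v _; rewrite lee_fin.
have am : a <= m.
  rewrite -lee_fin -fint -intZ; apply: ge0_le_integral => //.
  - by move=> v _; rewrite lee_fin.
  - exact/measurable_EFinP.
  - exact/measurable_EFinP.
  - by move=> v _; rewrite lee_fin /f; case: ifP.
pose U := [set v | N%:R < Z v].
have mU : measurable U.
  by rewrite -[U]setTI; apply: measurable_fun_ltr.
pose Big := \big[setU/set0]_(i < N) (x i @^-1` U).
pose Dev := [set w | N%:R * e <= `|S w - fine ('E_P[S])%E| ].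
have mxU i : measurable (x i @^-1` U).
  by rewrite -[_ @^-1` _]setTI; exact: measurable_funP.
have mBig : measurable Big by apply: bigsetU_measurable.
have mDev : measurable Dev.
  rewrite -[Dev]setTI; apply: measurable_fun_ler => //.
  apply: measurableT_comp => //; exact: measurable_funB.
have ES : 'E_P[S]%E = (N%:R * a)%:E.
  by rewrite (expectation_sum_rv ident mf f0 fN) size_iota fint EFinM.
apply: (@le_trans _ _ (P (Big `|` Dev))).
  apply: le_measure; rewrite ?inE//.
  - rewrite -[X in measurable X]setTI; apply: measurable_fun_ltr => //.
    exact: measurable_sum_rv.
  - exact: measurableU.
  - move=> w /= h; case: (pselect (exists2 i, i \in iota 0 N & U (x i w))).
      move=> [i]; rewrite mem_iota => /= iN Ui.
      by left; rewrite /Big -(bigcup_mkord N (fun i => x i @^-1` U)); exists i.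
    move=> nU; right; rewrite /Dev/= ES/=.
    have SE : S w = \sum_(i <- iota 0 N) Z (x i w).
      apply: eq_big_seq => i iN; rewrite /f; case: leP => // h'.
      by exfalso; apply: nU; exists i.
    rewrite SE; apply: le_trans (ler_norm _).
    by rewrite lerBrDr; apply: le_trans (ltW h); nra.
apply: (le_trans (measureU2 P mBig mDev)).
rewrite EFinD ge0_muleDl ?lee_fin ?invr_ge0 ?exprn_ge0 ?(ltW e0)// mul1e.
have dy0 v : (0 <= (dyadic_profile k (Z v))%:E)%E.
  by rewrite lee_fin dyadic_profile_ge0.
apply: leeD.
(* Union bound: [Big] has probability at most N times the law of [U], and the dyadic profile of [Z]
   equals N on [U]. *)
- apply: (le_trans (Boole_inequality P (A := fun i => x i @^-1` U) (fun i _ => mxU i))).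
  rewrite (eq_bigr (fun=> law U)); last first.
    by move=> i _; exact: ident.
  apply: (@le_trans _ _ (\int[law]_(v in U) (N%:R)%:E)%E).
    have lU : law U = (fine (law U))%:E by rewrite fineK// fin_num_measure.
    rewrite integral_cst//= [X in (_ <= _ * X)%E]lU lU.
    by rewrite sumEFin sumr_const card_ord -EFinM mulr_natl.
  apply: (@le_trans _ _ (\int[law]_(v in U) (dyadic_profile k (Z v))%:E)%E).
    apply: ge0_le_integral => //.
    + by apply: measurable_funTS.
    + by move=> v; rewrite /U/= lee_fin /dyadic_profile -NE (leNgt (Z v)) => ->.
  exact: ge0_subset_integral.
(* The variance is at most N times the mean of f^2, and f^2 is at most N times the profile; dividing
   by (N e)^2 leaves the factor 1/e^2. *)
- apply: le_trans (chebyshev (mfun_Sub (mem_set mS)) _) _; first exact: mulr_gt0.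
  rewrite mfun_valP.
  apply: (@le_trans _ _ (((N%:R * e) ^- 2)%:E * (N%:R%:E * (N%:R%:E * I)))%E); last first.
    rewrite !muleA -!EFinM; apply: lee_wpmul2r; first exact: integral_ge0.
    rewrite lee_fin le_eqVlt; apply/orP; left; apply/eqP.
    by field; rewrite !gt_eqF.
  apply: lee_wpmul2l; first by rewrite lee_fin invr_ge0 sqr_ge0.
  apply: (le_trans (variance_sum_le indep ident mf f0 fN (iota_uniq 0 N))).
  rewrite size_iota; apply: lee_wpmul2l => //.
  rewrite -ge0_integralZl_EFin//.
  apply: ge0_le_integral => //.
  + by move=> v _; rewrite lee_fin sqr_ge0.
  + by apply/measurable_EFinP; exact: measurable_funX.
  + by apply: emeasurable_funM.
  + move=> v _; rewrite -EFinM lee_fin /f /dyadic_profile -NE; case: ifP => _.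
      by rewrite mulrCA divff ?gt_eqF// mulr1.
    by rewrite expr0n/= mulr_ge0.
Qed.

(** The dyadic tails are summable because the profiles of [Z] add up to at most 4 Z. Passing from
    powers of 2 to every [n] uses monotonicity of the partial sums and costs the factor 2. *)
Lemma ae_sum_rv_le (e : R) : 0 < e ->
  {ae P, forall w, \forall n \near \oo,
    \sum_(i <- iota 0 n) Z (x i w) <= 2 * n%:R * (m + e)}.
Proof.
move=> e0.
pose F k := [set w | (2 ^ k)%N%:R * (m + e) < \sum_(i <- iota 0 (2 ^ k)) Z (x i w)].
have m0 : 0 <= m.
  by rewrite -lee_fin -intZ; apply: integral_ge0 => v _; rewrite lee_fin.
have : {ae P, forall w, \forall k \near \oo, ~ F k w}.
  apply: (@ae_eventually_not_le _ _ _ _ _ (fun k => (1 + e ^- 2)%:E * \int[law]_v (dyadic_profile k (Z v))%:E)%E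
     ((1 + e ^- 2) * (4 * m))).
  - move=> k; rewrite -[F k]setTI; apply: measurable_fun_ltr => //.
    exact: measurable_sum_rv.
  - by move=> k; exact: dyadic_tail.
  - move=> n; rewrite -ge0_sume_distrr; last first.
      by move=> k _; apply: integral_ge0 => v _; rewrite lee_fin dyadic_profile_ge0.
    rewrite EFinM; apply: lee_wpmul2l.
      by rewrite lee_fin addr_ge0// invr_ge0 sqr_ge0.
    have mdy k : measurable_fun setT (fun v => (dyadic_profile k (Z v))%:E : \bar R).
      apply/measurable_EFinP; apply: measurableT_comp => //.
      exact: measurable_dyadic_profile.
    rewrite -ge0_integral_sum//; last first.
      by move=> k v _; rewrite lee_fin dyadic_profile_ge0.
    rewrite EFinM -intZ -ge0_integralZl_EFin//; last 2 first.
      by move=> v _; rewrite lee_fin.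
      exact/measurable_EFinP.
    apply: ge0_le_integral => //.
    + move=> v _; apply: sume_ge0 => k _; by rewrite lee_fin dyadic_profile_ge0.
    + exact: emeasurable_sum.
    + by apply: emeasurable_funM => //; exact/measurable_EFinP.
    + by move=> v _; rewrite sumEFin -EFinM lee_fin sum_dyadic_profile_le.
(* Take k with 2^k <= n < 2^(k+1): the sum up to [n] is at most the sum up to 2^(k+1), and 2^(k+1)
   <= 2n. *)
apply: filterS => w [K _ FK]; exists (2 ^ K)%N => // n /= Kn.
have n0 : (0 < n)%N by apply: leq_trans Kn; rewrite expn_gt0.
have /andP[n1 n2] := trunc_log_bounds (isT : 1 < 2)%N n0.
set k := trunc_log 2 n in n1 n2.
have Kk : (K <= k)%N by rewrite trunc_log_max.
have /negP := FK k.+1 (leqW Kk); rewrite -leNgt => h.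
apply: (@le_trans _ _ (\sum_(i <- iota 0 (2 ^ k.+1)) Z (x i w))).
  rewrite -(subnKC (ltnW n2)) iotaD big_cat/= lerDl.
  by apply: sumr_ge0.
apply: (le_trans h); rewrite ler_wpM2r//; first by rewrite addr_ge0// ltW.
by rewrite expnS -natrM ler_nat leq_mul2l n1 orbT.
Qed.

End tail.

(** * The law of large numbers along arbitrary index subsets *)

(** Used to replace the subset [s n] by the full range of indices in the average of the nonnegative
    remainder. *)
Lemma ler_sum_uniq_subset (R : numDomainType) (I : eqType) (r s : seq I) (F : I -> R) :
  uniq r -> uniq s -> {subset s <= r} -> (forall i, 0 <= F i) ->
  \sum_(i <- s) F i <= \sum_(i <- r) F i.
Proof.
move=> ur us sr F0.
rewrite (perm_big [seq i <- r | i \in s])/=; last first.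
  apply: uniq_perm => //; first exact: filter_uniq.
  move=> i; rewrite mem_filter andb_idr//; exact: sr.
by rewrite big_filter [leLHS]big_mkcond/=; apply: ler_sum => i _; case: ifP.
Qed.

Section integrable_average.
Context d d' (T : measurableType d) (V : measurableType d') (R : realType)
  (P : probability T R) (x : nat -> {RV P >-> V}).
Context (indep : mutually_independent x).
Context (ident : identically_distributed x).
Context (s : nat -> seq nat) (us : forall n, uniq (s n))
  (sn : forall n, {subset s n <= iota 0 n}).

Let law := distribution P (x 0).

Lemma ge0_average_cvg0 (f : V -> R) (a : R) : measurable_fun setT f ->
  (forall v, 0 <= f v) -> (\int[law]_v (f v)%:E = a%:E)%E ->
  centered_average_cvg0 x s f a.
Proof.
move=> mf f0 fa.
have sizesn n : (size (s n) <= n)%N.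
  by rewrite -[leqRHS](size_iota 0); exact: uniq_leq_size.
have mfE : measurable_fun setT (EFin \o f) by exact/measurable_EFinP.
pose g := nnsfun_approx measurableT mfE.
have gcvg v : EFin \o g ^~ v @ \oo --> (f v)%:E.
  by apply: (@cvg_nnsfun_approx _ _ _ setT measurableT _ mfE) => // u _; rewrite lee_fin.
have gnd v : nondecreasing_seq (g ^~ v).
  by move=> i j ij; have /lefP := nd_nnsfun_approx measurableT mfE ij; exact.
have gf k v : g k v <= f v.
  have /fine_cvgP[_ gv] := gcvg v.
  have -> : f v = limn (g ^~ v) by apply/esym/cvg_lim.
  by apply: nondecreasing_cvgn_le => //; apply: cvgP gv.
pose ak k := fine (\int[law]_v (g k v)%:E)%E.
have g0 k v : 0 <= g k v by exact: fun_ge0.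
have mg k : measurable_fun setT (g k : V -> R) by [].
have gint k : (\int[law]_v (g k v)%:E = (ak k)%:E)%E.
  rewrite fineK// ge0_fin_numE; last by apply: integral_ge0 => v _; rewrite lee_fin.
  apply: (@le_lt_trans _ _ (\int[law]_v (f v)%:E)%E); last by rewrite fa ltry.
  by apply: ge0_le_integral => //; [move=> v _; rewrite lee_fin|exact/measurable_EFinP|move=> v _; rewrite lee_fin].
(* Monotone convergence makes the mean of the remainder [Z k] tend to 0. *)
have akcvg : ak k @[k --> \oo] --> a.
  have : (\int[law]_v (g k v)%:E)%E @[k --> \oo] --> (\int[law]_v (f v)%:E)%E.
    rewrite (_ : (fun v => (f v)%:E) = (fun v => limn (fun k => (g k v)%:E))); last first.
      by apply/funext => v; apply/esym/cvg_lim => //; exact: gcvg.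
    apply: cvg_monotone_convergence => //.
    - by move=> k; exact/measurable_EFinP.
    - by move=> k v _; rewrite lee_fin.
    - by move=> v _ i j ij; rewrite lee_fin gnd.
  by rewrite fa => /fine_cvgP[].
pose Z k v := f v - g k v.
have mZ k : measurable_fun setT (Z k) by exact: measurable_funB.
have Z0 k v : 0 <= Z k v by rewrite subr_ge0.
have Zint k : (\int[law]_v (Z k v)%:E = (a - ak k)%:E)%E.
  have : (\int[law]_v (Z k v)%:E + \int[law]_v (g k v)%:E = a%:E)%E.
    rewrite -ge0_integralD//; last 4 first.
    - by move=> v _; rewrite lee_fin.
    - exact/measurable_EFinP.
    - by move=> v _; rewrite lee_fin.
    - exact/measurable_EFinP.
    by rewrite -fa; apply: eq_integral => v _; rewrite -EFinD subrK.
  (* The sum with the real number [ak k] is real, which rules out an infinite integral of [Z k]. *)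
  rewrite gint; case: (\int[law]_v (Z k v)%:E)%E => // r.
  by rewrite -EFinD => -[<-]; rewrite addrK.
have aka k : ak k <= a.
  rewrite -subr_ge0 -lee_fin -Zint; apply: integral_ge0 => v _.
  by rewrite lee_fin.
have H1 : {ae P, forall w, forall k,
    n%:R^-1 * \sum_(i <- s n) (g k (x i w) - ak k) @[n --> \oo] --> 0}.
  by apply/ae_foralln => k; exact: nnsfun_average_cvg0.
have H2 : {ae P, forall w, forall k, \forall n \near \oo,
    \sum_(i <- iota 0 n) Z k (x i w) <= 2 * n%:R * (a - ak k + k.+1%:R^-1)}.
  by apply/ae_foralln => k; apply: (ae_sum_rv_le indep ident (mZ k) (Z0 k) (Zint k)).
rewrite /centered_average_cvg0.
apply: filterS2 H1 H2 => w H1 H2.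
apply/cvgr0Pnorm_le => e e0.
(* Error budget per index: e/8 for the simple function, 2 (e/8 + e/8) = e/2 for the remainder, e/8
   for the centering [a - ak k]; the total stays below e. *)
have e8 : 0 < e / 8 by rewrite divr_gt0.
have [k [k1 k2]] : exists k, a - ak k <= e / 8 /\ k.+1%:R^-1 <= e / 8 :> R.
  have c1 : \forall k \near \oo, a - ak k <= e / 8.
    move/cvgrPdist_le : akcvg => /(_ _ e8); apply: filterS => k.
    by rewrite ger0_norm// subr_ge0.
  have c2 : \forall k \near \oo, k.+1%:R^-1 <= e / 8 :> R.
    have [j] := ltr_add_invr e8; rewrite add0r => /ltW je.
    exists j => // k /= jk; apply: le_trans je.
    by rewrite lef_pV2 ?posrE// ler_nat ltnS.
  by near \oo => k; exists k; split; near: k.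
near=> n.
have n0 : 0 < n%:R :> R by rewrite ltr0n; near: n; exact: nbhs_infty_gt.
have h1 : `|n%:R^-1 * \sum_(i <- s n) (g k (x i w) - ak k)| <= e / 8.
  by near: n; exact: ((cvgr0Pnorm_le _).1 (H1 k)).
have h2 : \sum_(i <- iota 0 n) Z k (x i w) <= 2 * n%:R * (a - ak k + k.+1%:R^-1).
  by near: n; exact: H2.
have h3 : \sum_(i <- s n) Z k (x i w) <= \sum_(i <- iota 0 n) Z k (x i w).
  by apply: ler_sum_uniq_subset => //; exact: iota_uniq.
have h4 : 0 <= \sum_(i <- s n) Z k (x i w) by apply: sumr_ge0.
have h5 : (size (s n))%:R <= n%:R :> R by rewrite ler_nat.
have E1 : \sum_(i <- s n) (f (x i w) - a) =
    \sum_(i <- s n) (g k (x i w) - ak k) + \sum_(i <- s n) Z k (x i w)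
    - (size (s n))%:R * (a - ak k).
  rewrite /Z !sumrB !big_const_seq !count_predT !iter_addr_0 -[a *+ _]mulr_natl -[ak k *+ _]mulr_natl.
  by ring.
have h6 : `|\sum_(i <- s n) (g k (x i w) - ak k)| <= n%:R * (e / 8).
  by move: h1; rewrite normrM gtr0_norm ?invr_gt0// ler_pdivrMl.
rewrite normrM gtr0_norm ?invr_gt0// ler_pdivrMl// E1.
move: h6; rewrite !ler_norml => /andP[h7 h8].
have ak0 := aka k; rewrite -subr_ge0 in ak0.
have h9 : (size (s n))%:R * (a - ak k) <= n%:R * (e / 8).
  by apply: ler_pM.
have h10 : 0 <= (size (s n))%:R * (a - ak k) by apply: mulr_ge0.
have h11 : 2 * n%:R * (a - ak k + k.+1%:R^-1) <= 2 * n%:R * (e / 4).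
  by rewrite ler_wpM2l ?mulr_ge0// (le_trans (lerD k1 k2))//; lra.
have h12 : 0 <= n%:R * (e / 8) by rewrite mulr_ge0// ltW.
move: h2 h3 h4 h7 h8 h9 h10 h11 h12; clear -n0.
move: (\sum_(i <- s n) _) (\sum_(i <- s n) _) (\sum_(i <- iota 0 n) _) (_ * (a - ak k)) (_ * (a - ak k + _)).
move=> A1 A2 A3 A4 A5 h2 h3 h4 h7 h8 h9 h10 h11 h12.
by apply/andP; split; lra.
Unshelve. all: by end_near. Qed.

(** [f] is the difference of the nonnegative integrable functions f + |f| and |f|, whose means are a
    + b and b. *)
Lemma integrable_average_cvg0 (f : V -> R) (a : R) :
  law.-integrable setT (EFin \o f) -> (\int[law]_v (f v)%:E = a%:E)%E ->
  centered_average_cvg0 x s f a.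
Proof.
move=> intf fa.
have mf : measurable_fun setT f by apply/measurable_EFinP; exact: measurable_int intf.
have intn : law.-integrable setT (EFin \o (Num.norm \o f)) by exact: integrable_norm.
pose f1 v := f v + `|f v|; pose f2 v := `|f v|.
have mf2 : measurable_fun setT f2 by exact: measurableT_comp.
have mf1 : measurable_fun setT f1 by exact: measurable_funD.
have c0 : (\int[law]_v (f2 v)%:E)%E \is a fin_num by exact: integrable_fin_num.
pose b := fine (\int[law]_v (f2 v)%:E)%E.
have H2 : centered_average_cvg0 x s f2 b.
  by apply: ge0_average_cvg0 => //; [move=> v; exact: normr_ge0|rewrite fineK].
have H1 : centered_average_cvg0 x s f1 (a + b).
  apply: ge0_average_cvg0 => //.
    by move=> v; rewrite /f1; have := ler_norm (- f v); rewrite normrN; lra.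
  rewrite EFinD -fa fineK// -integralD_EFin//.
rewrite /centered_average_cvg0 in H1 H2 *.
apply: filterS2 H1 H2 => w H1 H2.
rewrite (_ : (fun n => _) = (fun n => n%:R^-1 * \sum_(i <- s n) (f1 (x i w) - (a + b)) -
    n%:R^-1 * \sum_(i <- s n) (f2 (x i w) - b))); last first.
  apply/funext => n; rewrite -mulrBr -sumrB; congr (_ * _).
  by apply: eq_bigr => i _; rewrite /f1 /f2; ring.
rewrite -[X in _ --> X](subrr 0).
exact: cvgB.
Qed.

End integrable_average.

(** * The limiting matrix polynomial *)

(** Both sides stand for ((1 + N)^n - 1)/N, here without dividing by [N]; the induction step is
    Pascal's rule. *)
Lemma sum_geometric_binomial (A : pzRingType) (N : A) n :
  \sum_(0 <= j < n) (1 + N) ^+ j = \sum_(0 <= i < n) N ^+ i *+ 'C(n, i.+1).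
Proof.
elim: n => [|n IH]; first by rewrite !big_geq.
rewrite big_nat_recr//= IH addrC -(addrC N) exprD1n.
rewrite -(big_mkord xpredT (fun i => N ^+ i *+ 'C(n, i))).
(* The range is extended by the term i = n, which vanishes since C(n, n+1) = 0, so that the two sums
   can be added termwise. *)
rewrite [in LHS](_ : \sum_(0 <= i < n) _ = \sum_(0 <= i < n.+1) N ^+ i *+ 'C(n, i.+1)); last first.
  by rewrite [RHS]big_nat_recr//= bin_small// mulr0n addr0.
rewrite -big_split/=; apply: eq_bigr => i _.
by rewrite -mulrnDr binS addnC.
Qed.

(** Identifies the binomial coefficient of the geometric sum, divided by B, with the factorial
    coefficient in [shrinkage_poly]. *)
Lemma bin_ratio (R : numFieldType) (B i : nat) : (i < B)%N ->
  B%:R^-1 * ('C(B, i.+1))%:R = (B.-1)`!%:R / ((i.+1)`!%:R * (B.-1 - i)`!%:R) :> R.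
Proof.
case: B => // B; rewrite ltnS => iB /=.
have f0 n : n`!%:R != 0 :> R by rewrite pnatr_eq0 -lt0n fact_gt0.
apply: (canRL (mulfK _)); first by rewrite mulf_neq0.
rewrite -!natrM -mulrA -!natrM.
have -> : ('C(B.+1, i.+1) * (i.+1`! * (B - i)`!) = B.+1`!)%N.
  by rewrite -(@bin_fact B.+1 i.+1)// subSS.
by rewrite factS natrM mulKf// pnatr_eq0.
Qed.

Lemma exprmxZ (R : comPzRingType) p (a : R) (S : 'M[R]_p) i :
  (a *: S) ^+ i = a ^+ i *: S ^+ i.
Proof.
elim: i => [|i IH]; first by rewrite !expr0 scale1r.
rewrite !exprS IH -[LHS]/((a *: S) *m (a ^+ i *: S ^+ i)).
by rewrite -scalemxAl -scalemxAr scalerA.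
Qed.

(** Expand the geometric sum with N = - a S. The term i = 0 is C(B, 1)/B = 1, the identity; the
    others carry (-1)^i = - (-1)^(i+1), the sign in front of [shrinkage_poly]. *)
Lemma one_sub_shrinkage_poly (R : realType) (p B : nat) (alpha : R) (S : 'M[R]_p) :
  (0 < B)%N ->
  1%:M - shrinkage_poly B alpha S =
  B%:R^-1 *: \sum_(0 <= j < B) (1%:M - (alpha / B%:R) *: S) ^+ j.
Proof.
move=> B0; set a := alpha / B%:R.
rewrite (sum_geometric_binomial (- (a *: S) : 'M[R]_p)) scaler_sumr.
rewrite big_ltn// expr0 bin1 -(scaler_nat B (1 : 'M[R]_p)) scalerA mulVf ?pnatr_eq0 -?lt0n// scale1r.
congr (_ + _); rewrite /shrinkage_poly -sumrN.
apply: eq_big_nat => i /andP[i0 iB].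
have -> : (- (a *: S)) ^+ i = (- a) ^+ i *: S ^+ i by rewrite -scaleNr exprmxZ.
rewrite -[X in _ = _ *: X]scaler_nat -[LHS]scaleNr 2!scalerA -(@bin_ratio R B i iB) -/a.
congr (_ *: _).
by rewrite (exprNn a) exprS; ring.
Qed.

Lemma count_ltn_iota m n : (m <= n)%N -> count (fun j => (j < m)%N) (iota 0 n) = m.
Proof.
move=> mn; rewrite -(subnKC mn) iotaD count_cat add0n.
rewrite (@eq_in_count _ _ predT) ?count_predT ?size_iota; last first.
  by move=> j; rewrite mem_iota => /andP[_ ->].
rewrite (@eq_in_count _ _ pred0) ?count_pred0 ?addn0// => j.
by rewrite mem_iota => /andP[mj _]; rewrite ltnNge mj.
Qed.

(** For a fixed permutation tau, batch b contributes the power of exponent tau^-1(b), and these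
    exponents run once through 0, ..., B-1. The sum over b is thus the same for every tau, and
    averaging leaves it unchanged. *)
Lemma batch_prod_const (R : realType) (p B : nat) (S : 'M[R]_p) (a : R) :
  \sum_(b < B) batch_prod (fun=> S) a b = \sum_(0 <= j < B) (1%:M - a *: S) ^+ j.
Proof.
rewrite /batch_prod -scaler_sumr exchange_big/=.
have count_lt (m : 'I_B) : count (fun j : 'I_B => (j < m)%N) (rev (enum 'I_B)) = m.
  rewrite count_rev -(count_map val (fun j => (j < m)%N)) val_enum_ord.
  by rewrite count_ltn_iota// ltnW.
rewrite (eq_bigr (fun=> \sum_(0 <= j < B) (1%:M - a *: S) ^+ j)); last first.
  move=> tau _; rewrite big_mkord [RHS](reindex_inj (@perm_inj _ (tau^-1)%g)) /=.
  by apply: eq_bigr => b _; rewrite big_const_seq count_lt -Monoid.iteropE.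
rewrite sumr_const card_Sn -[X in _ *: X]scaler_nat scalerA mulVf ?scale1r//.
Qed.

(** * Limits of matrix expressions *)

(** Neighbourhoods of a matrix are generated by families of entrywise neighbourhoods, and there are
    finitely many entries to intersect over. *)
Lemma cvg_mxP (R : realFieldType) (I : Type) (F : set_system I) (FF : Filter F) m n
    (M : I -> 'M[R]_(m, n)) (L : 'M[R]_(m, n)) :
  (forall i j, M k i j @[k --> F] --> L i j) -> M @ F --> L.
Proof.
move=> ML A [Q LQ QA]; rewrite nbhs_filterE /=.
have : \forall k \near F, forall i j, Q i j (M k i j).
  by apply: filter_forall => i; apply: filter_forall => j; exact: ML (LQ i j).
by apply: filterS => k; exact: QA.
Qed.

Lemma cvg_mx_coord (R : realFieldType) (I : Type) (F : set_system I) m n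
    (M : I -> 'M[R]_(m, n)) (L : 'M[R]_(m, n)) i j :
  M @ F --> L -> M k i j @[k --> F] --> L i j.
Proof.
move=> ML; exact: (cvg_comp _ _ ML (@coord_continuous R m n i j L)).
Qed.

Section matrix_limits.
Context (R : realFieldType) (I : Type) (F : set_system I) (FF : Filter F).

Lemma cvg_mulmx m n q (M : I -> 'M[R]_(m, n)) (N : I -> 'M[R]_(n, q)) (L : 'M[R]_(m, n)) (K : 'M[R]_(n, q)) :
  M @ F --> L -> N @ F --> K -> M k *m N k @[k --> F] --> L *m K.
Proof.
move=> ML NK; apply: cvg_mxP => i j; rewrite mxE; under eq_fun do rewrite mxE.
apply: cvg_big => [|k _]; first exact: add_continuous.
by apply: cvgM; exact: cvg_mx_coord.
Qed.

Lemma cvg_sum_mx m n (J : Type) (r : seq J) (M : J -> I -> 'M[R]_(m, n)) (L : J -> 'M[R]_(m, n)) :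
  (forall j, M j @ F --> L j) ->
  \sum_(j <- r) M j k @[k --> F] --> \sum_(j <- r) L j.
Proof.
move=> ML; apply: cvg_mxP => i j; rewrite summxE; under eq_fun do rewrite summxE.
apply: cvg_big => [|k _]; first exact: add_continuous.
exact: cvg_mx_coord.
Qed.

Lemma cvg_scalemx m n (a : R) (M : I -> 'M[R]_(m, n)) (L : 'M[R]_(m, n)) :
  M @ F --> L -> a *: M k @[k --> F] --> a *: L.
Proof.
move=> ML; apply: cvg_mxP => i j; rewrite mxE; under eq_fun do rewrite mxE.
by apply: cvgM; [exact: cvg_cst|exact: cvg_mx_coord].
Qed.

Lemma cvg_subr_mx m n (A : 'M[R]_(m, n)) (M : I -> 'M[R]_(m, n)) (L : 'M[R]_(m, n)) :
  M @ F --> L -> A - M k @[k --> F] --> A - L.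
Proof.
move=> ML; apply: cvg_mxP => i j; rewrite !mxE; under eq_fun do rewrite !mxE.
by apply: cvgB; [exact: cvg_cst|exact: cvg_mx_coord].
Qed.

Lemma cvg_prod_mx n (J : Type) (r : seq J) (Q : pred J) (M : J -> I -> 'M[R]_n) (L : J -> 'M[R]_n) :
  (forall j, M j @ F --> L j) ->
  \prod_(j <- r | Q j) M j k @[k --> F] --> \prod_(j <- r | Q j) L j.
Proof.
move=> ML; elim: r => [|j r IH].
  by rewrite big_nil; under eq_fun do rewrite big_nil; exact: cvg_cst.
rewrite big_cons; under eq_fun do rewrite big_cons.
by case: ifP => // _; apply: cvg_mulmx.
Qed.

End matrix_limits.

Lemma cvg_batch_prod (R : realType) (p B : nat) (I : Type) (F : set_system I)
    (FF : Filter F) (W : I -> 'I_B -> 'M[R]_p) (S : 'M[R]_p) (a : R) b :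
  (forall b, W k b @[k --> F] --> S) ->
  batch_prod (W k) a b @[k --> F] --> batch_prod (fun=> S) a b.
Proof.
move=> WS; apply: cvg_scalemx; apply: cvg_sum_mx => tau.
by apply: cvg_prod_mx => j; apply: cvg_subr_mx; apply: cvg_scalemx; exact: WS.
Qed.

(** Since X_b^T X_b / n = W_b / B, the cross-covariance depends on the data only through a fixed
    polynomial in the [batch_cov], so its limit follows from theirs. *)
Lemma cross_covE (R : realType) (n p B : nat) (X : 'M[R]_(n, p))
    (c : 'I_n -> 'I_B) (a : R) : (0 < n)%N -> (0 < B)%N ->
  cross_cov X c a =
  B%:R^-1 *: \sum_(b < B) batch_prod (batch_cov X c) a b *m batch_cov X c b.
Proof.
move=> n0 B0; rewrite /cross_cov !scaler_sumr; apply: eq_bigr => b _.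
rewrite -mulmxA [in X in _ = _ *: (_ *m X)]/batch_cov -scalemxAr scalerA; congr (_ *: _).
by rewrite mulKf// pnatr_eq0 -lt0n.
Qed.

Lemma cvg_cross_cov (R : realType) (p B : nat) (a : R) (S : 'M[R]_p)
    (X : forall n, 'M[R]_(n, p)) (c : forall n, 'I_n -> 'I_B)
    (F : set_system nat) (FF : Filter F) : (0 < B)%N ->
  (\forall n \near F, (0 < n)%N) ->
  (forall b, batch_cov (X n) (c n) b @[n --> F] --> S) ->
  cross_cov (X n) (c n) a @[n --> F] -->
  S *m (B%:R^-1 *: \sum_(0 <= j < B) (1%:M - a *: S) ^+ j).
Proof.
move=> B0 Fn WS.
have -> : S *m (B%:R^-1 *: \sum_(0 <= j < B) (1%:M - a *: S) ^+ j) =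
    B%:R^-1 *: \sum_(b < B) batch_prod (fun=> S) a b *m S.
  rewrite -mulmx_suml batch_prod_const -scalemxAr; congr (_ *: _).
  (* The limit has [S] to the right of the geometric sum; commuting with every polynomial in [S], it
     can be moved to the left. *)
  have cS : GRing.comm S (1%:M - a *: S).
    rewrite /GRing.comm -[LHS]/(S *m _) -[RHS]/(_ *m S) mulmxBr mulmxBl mulmx1 mul1mx.
    by rewrite -scalemxAl -scalemxAr.
  have : GRing.comm S (\sum_(0 <= j < B) (1%:M - a *: S) ^+ j).
    by apply: commr_sum => j _; exact: commrX.
  done.
apply: (@cvg_trans _ ((fun n => B%:R^-1 *: \sum_(b < B)
    batch_prod (batch_cov (X n) (c n)) a b *m batch_cov (X n) (c n) b) @ F)).
  apply: near_eq_cvg; apply: filterS Fn => n n0.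
  by rewrite cross_covE.
apply: cvg_scalemx; apply: cvg_sum_mx => b.
by apply: cvg_mulmx => //; exact: cvg_batch_prod.
Qed.

(** * Empirical second moments of the mini-batches *)

(** Coordinates are continuous, so preimages of the open rays generating the real Borel sets are
    open. *)
Lemma measurable_cV_coord (R : realType) p (j : 'I_p) :
  measurable_fun setT (fun v : borel_cV R p => (v : 'cV[R]_p) j 0).
Proof.
apply: (measurability _ (RGenOInfty.measurableE R)) => _ [_ [r ->] <-].
rewrite setTI; apply: sub_sigma_algebra.
apply: (@open_comp _ _ (fun v : 'cV[R]_p => v j 0)); last exact: interval_open.
by move=> v _; exact: coord_continuous.
Qed.

(** Domination by u^2 + v^2, which follows from the squares of u + v and u - v being nonnegative. *)
Lemma integrable_mul_sqr d (T : measurableType d) (R : realType)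
    (mu : {measure set T -> \bar R}) (u v : T -> R) :
  measurable_fun setT u -> measurable_fun setT v ->
  (\int[mu]_x (u x ^+ 2)%:E < +oo)%E -> (\int[mu]_x (v x ^+ 2)%:E < +oo)%E ->
  mu.-integrable setT (fun x => (u x * v x)%:E).
Proof.
move=> mu_ mv iu iv.
have sq (f : T -> R) : measurable_fun setT f -> (\int[mu]_x (f x ^+ 2)%:E < +oo)%E ->
    mu.-integrable setT (fun x => (f x ^+ 2)%:E).
  move=> mf fi; apply/integrableP; split.
    by apply/measurable_EFinP; exact: measurable_funX.
  by under eq_integral do rewrite gee0_abs ?lee_fin ?sqr_ge0//.
apply: (le_integrable measurableT _ _ (integrableD measurableT (sq _ mu_ iu) (sq _ mv iv))).
  by apply/measurable_EFinP; exact: measurable_funM.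
move=> w _ /=; rewrite lee_fin [leRHS]ger0_norm ?addr_ge0 ?sqr_ge0//.
rewrite ler_norml; apply/andP; split.
  by have := sqr_ge0 (u w + v w); have := sqr_ge0 (u w); have := sqr_ge0 (v w); rewrite sqrrD; lra.
by have := sqr_ge0 (u w - v w); have := sqr_ge0 (u w); have := sqr_ge0 (v w); rewrite sqrrB; lra.
Qed.

Lemma batch_covE (R : realType) (p B n : nat) (u : nat -> 'cV[R]_p)
    (c : 'I_n -> 'I_B) b j k :
  batch_cov (data_matrix u n) c b j k =
  B%:R * (n%:R^-1 * \sum_(i <- [seq val i | i <- enum (batch c b)]) u i j 0 * u i k 0).
Proof.
rewrite /batch_cov mxE mulrA; congr (_ * _).
rewrite mxE big_map big_enum/= [RHS]big_enum_val; apply: eq_bigr => i _.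
by rewrite !mxE.
Qed.

Theorem proposition3p13 (R : realType) (d : measure_display)
    (T : measurableType d) (P : probability T R)
    (p B : nat) (hp : (1 <= p)%N) (hB : (1 <= B)%N)
    (alpha : R) (halpha : 0 <= alpha)
    (x : nat -> {RV P >-> borel_cV R p}) (Sigma : 'M[R]_p)
    (hindep : mutually_independent x)
    (hident : identically_distributed x)
    (hSigma : forall (i : nat) (j k : 'I_p),
       ('E_P[fun w => ((x i w : 'cV[R]_p) *m (x i w : 'cV[R]_p)^T)%R j k]
       = (Sigma j k)%:E)%E)
    (c : forall n : nat, 'I_n -> 'I_B)
    (hc : forall n : nat, (B %| n)%N -> equal_batches (c n)) :
  {ae P, forall w,
     cross_cov (data_matrix (fun i => x i w : 'cV[R]_p) n) (c n) (alpha / B%:R)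
       @[n --> within [set n | (B %| n)%N] \oo]
     --> Sigma *m (1%:M - shrinkage_poly B alpha Sigma)}.
Proof.
pose f (j k : 'I_p) (v : borel_cV R p) := (v : 'cV[R]_p) j 0 * (v : 'cV[R]_p) k 0.
have mcoord := @measurable_cV_coord R p.
have intP j k : (\int[P]_w (f j k (x 0%N w))%:E = (Sigma j k)%:E)%E.
  rewrite -(hSigma 0 j k) unlock; apply: eq_integral => w _.
  by rewrite !mxE big_ord1 !mxE.
have mx j : measurable_fun setT (fun w => (x 0%N w : 'cV[R]_p) j 0).
  exact: (measurableT_comp (mcoord j)).
(* The diagonal entries of [Sigma] supply finite second moments, from which the integrability of all
   products of coordinates follows. *)
have fin2P j : (\int[P]_w (((x 0%N w : 'cV[R]_p) j 0) ^+ 2)%:E < +oo)%E.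
  under eq_integral do rewrite expr2.
  by rewrite [ltLHS]intP ltry.
have fin2 j : (\int[distribution P (x 0%N)]_v (((v : 'cV[R]_p) j 0) ^+ 2)%:E < +oo)%E.
  rewrite -(integral_rv_law hident 0 (f := fun v : borel_cV R p => ((v : 'cV[R]_p) j 0) ^+ 2)) //.
  - exact: measurable_funX.
  - by move=> v; exact: sqr_ge0.
have intL j k : (\int[distribution P (x 0%N)]_v (f j k v)%:E = (Sigma j k)%:E)%E.
  rewrite -intP (integral_distribution (X := x 0%N) (f := EFin \o f j k)) //.
  - by apply/measurable_EFinP; exact: measurable_funM.
  - exact: integrable_mul_sqr.
pose s b n := [seq val i | i <- enum (batch (c n) b)].
have ae_avg : {ae P, forall w, forall b j k,
    n%:R^-1 * \sum_(i <- s b n) (f j k (x i w) - Sigma j k) @[n --> \oo] --> 0}.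
  apply: filter_forall => b; apply: filter_forall => j; apply: filter_forall => k.
  apply: (integrable_average_cvg0 hindep hident).
  - by move=> n; rewrite map_inj_uniq ?enum_uniq//; exact: val_inj.
  - by move=> n i /mapP[i' _ ->]; rewrite mem_iota/= ltn_ord.
  - exact: integrable_mul_sqr.
  - exact: intL.
have B0 : B%:R != 0 :> R by rewrite pnatr_eq0 -lt0n.
apply: filterS ae_avg => w avg; rewrite one_sub_shrinkage_poly//.
(* [n = 0] is also a multiple of [B]; it is discarded because [n] tends to infinity. *)
have npos : \forall n \near within [set n | (B %| n)%N] \oo, (0 < n)%N.
  by apply: cvg_within; exact: nbhs_infty_gt.
have FF : Filter (within [set n | (B %| n)%N] \oo) by exact: within_filter.
apply: cvg_cross_cov => // b; apply: cvg_mxP => j k.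
(* When [B] divides [n], each batch has n/B elements, so B/n times the total centering (n/B)
   [Sigma j k] is exactly [Sigma j k]. *)
apply: (@cvg_trans _ ((fun n => B%:R * (n%:R^-1 *
    \sum_(i <- s b n) (f j k (x i w) - Sigma j k)) + Sigma j k)
    @ within [set n | (B %| n)%N] \oo)).
  apply: near_eq_cvg; near=> n.
  have n0 : n%:R != 0 :> R by rewrite pnatr_eq0 -lt0n; near: n.
  have Bn : (B %| n)%N by near: n; exact: withinT.
  rewrite batch_covE sumrB big_const_seq count_predT iter_addr_0.
  have -> : size (s b n) = (n %/ B)%N by rewrite size_map -cardE hc.
  rewrite 2!mulrBr (_ : B%:R * (_ * (_ *+ _)) = Sigma j k) ?subrK//.
  by rewrite -[Sigma j k *+ _]mulr_natl mulrCA [B%:R * _]mulrA -natrM mulnC divnK// mulKf.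
have -> : nbhs (Sigma j k) = nbhs (B%:R * 0 + Sigma j k) by rewrite mulr0 add0r.
apply: cvgD; last exact: cvg_cst.
apply: cvgM; first exact: cvg_cst.
exact: (cvg_trans (cvg_app _ (cvg_within _)) (avg b j k)).
Unshelve. all: by end_near. Qed.
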